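(* Let $p$ be an odd prime, $m,s$ positive integers, and $\mathcal{R}=\mathbb{F}_{p^m}[u,v]/\langle u^2,v^2,uv-vu\rangle$. Let $\alpha=\alpha_1+\alpha_3v+\alpha_4uv\in\mathcal{R}$ with $\alpha_1,\alpha_3,\alpha_4\in\mathbb{F}_{p^m}^*$, and suppose $\alpha$ is not a square in $\mathcal{R}$. Let $\alpha_0\in\mathbb{F}_{p^m}$ be the element with $\alpha_0^{p^s}=\alpha_1$. Let $\mathcal{C}=\langle u(x^2-\alpha_0)^\ell\rangle$ be the ideal of $\mathcal{R}_\alpha=\mathcal{R}[x]/\langle x^{2p^s}-\alpha\rangle$, where $0\le\ell\le 2p^s-1$. Then the symbol-pair distance of $\mathcal{C}$ is $$d_{sp}(\mathcal{C})=\begin{cases}2 & \text{if } 0\le\ell\le p^s;\\ 2(\Gamma+1)p^{\gamma} & \text{if } 2p^s-p^{s-\gamma}+(\Gamma-1)p^{s-\gamma-1}+1\le\ell\le 2p^s-p^{s-\gamma}+\Gamma p^{s-\gamma-1},\\ & \text{where } 1\le\Gamma\le p-1 \text{ and } 0\le\gamma\le s-1.\end{cases}$$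
   Context: Elements of $\mathcal{R}_\alpha=\mathcal{R}[x]/\langle x^{2p^s}-\alpha\rangle$ are identified with vectors in $\mathcal{R}^{2p^s}$: the class whose representative of degree less than $2p^s$ is $\zeta_0+\zeta_1x+\cdots+\zeta_{2p^s-1}x^{2p^s-1}$ corresponds to $(\zeta_0,\ldots,\zeta_{2p^s-1})$. Ideals of $\mathcal{R}_\alpha$ are thereby the $\alpha$-constacyclic codes of length $2p^s$ over $\mathcal{R}$. For vectors $x=(x_0,\ldots,x_{n-1})$, $y=(y_0,\ldots,y_{n-1})$ over an alphabet, the symbol-pair distance is $d_{sp}(x,y)=|\{i:0\le i\le n-1,\ (x_i,x_{i+1})\ne(y_i,y_{i+1})\}|$, indices taken modulo $n$; for a code $\mathcal{C}$ with at least two words, $d_{sp}(\mathcal{C})=\min\{d_{sp}(x,y):x,y\in\mathcal{C},x\ne y\}$. *)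

(* Defs.v *)
From HB Require Import structures.
From mathcomp Require Import all_boot all_order all_algebra.
From mathcomp Require Import boolp classical_sets.
From mathcomp Require Import mpoly.

Set Implicit Arguments.
Unset Strict Implicit.
Unset Printing Implicit Defensive.

Import GRing.Theory.
Local Open Scope ring_scope.

Section GeneratedIdeal.
Variable A : comNzRingType.

Definition gen_ideal (g : seq A) : {pred A} :=
  fun x => `[< exists c : 'I_(size g) -> A, x = \sum_i c i * g`_i >].

Lemma gen_ideal_lin (g : seq A) (a : A) :
  {in gen_ideal g &, forall x y, a * x + y \in gen_ideal g}.
Proof.
move=> x y /asboolP[c ->] /asboolP[d ->]; apply/asboolP.
exists (fun i => a * c i + d i); rewrite mulr_sumr -big_split.
by apply: eq_bigr => i _; rewrite mulrDl mulrA.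
Qed.

Lemma gen_ideal0 (g : seq A) : 0 \in gen_ideal g.
Proof. by apply/asboolP; exists (fun=> 0); rewrite big1// => i; rewrite mul0r. Qed.

End GeneratedIdeal.

(* F[u, v] is {mpoly F[2]} with u = 'X_0 and v = 'X_1. *)
Section RingR.
Variable F : fieldType.

Let U : {mpoly F[2]} := 'X_ord0.
Let V : {mpoly F[2]} := 'X_ord_max.

Definition relR : {pred {mpoly F[2]}} :=
  gen_ideal [:: U ^+ 2; V ^+ 2; U * V - V * U].

Lemma relR_idealr_closed : idealr_closed relR.
Proof.
split; [exact: gen_ideal0| |exact: gen_ideal_lin].
apply/negP => /asboolP[c /(congr1 (meval (fun=> 0)))].
rewrite meval1 raddf_sum !big_ord_recr big_ord0 /=.
rewrite !mevalM !mevalXU !mevalB !mevalM !mevalXU !mulr0 subr0 mulr0 !addr0.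
by move/eqP; rewrite oner_eq0.
Qed.

HB.instance Definition _ :=
  isIdealr.Build {mpoly F[2]} relR relR_idealr_closed.

Definition ringR := {ideal_quot relR}.

HB.instance Definition _ := GRing.ComNzRing.on ringR.

Definition projR (f : {mpoly F[2]}) : ringR := \pi_({ideal_quot relR})%qT f.
Definition constR (a : F) : ringR := projR a%:MP.
Definition uR : ringR := projR U.
Definition vR : ringR := projR V.

End RingR.

Arguments uR {F}.
Arguments vR {F}.

Section Constacyclic.
Variables (A : comNzRingType) (n : nat) (a : A).

(* For 0 < n the modulus is monic of positive degree, so qpoly really divides
   by it (not by its fallback 'X), and an element of the quotient is its
   representative of degree less than n. *)
Definition constacyclic_ring := {poly %/ ('X^n - a%:P)}.

Definition word_of (f : constacyclic_ring) : 'rV[A]_n :=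
  poly_rV (f : {poly A}).

Definition code_of (I : {pred constacyclic_ring}) : set 'rV[A]_n :=
  [set w | exists2 f, f \in I & w = word_of f]%classic.

End Constacyclic.

Section SymbolPair.
Variables (A : eqType) (n : nat).

Definition sp_dist (x y : 'rV[A]_n) : nat :=
  #|[set i : 'I_n |
      (x ord0 i, x ord0 (ordS i)) != (y ord0 i, y ord0 (ordS i))]|.

Definition sp_dists (C : set 'rV[A]_n) : pred nat :=
  fun d => `[< exists x y, [/\ C x, C y, x <> y & sp_dist x y = d] >].

(* 0 when the code has fewer than two words; two distinct words are always at
   positive distance. *)
Definition code_sp_dist (C : set 'rV[A]_n) : nat :=
  if pselect (exists d, sp_dists C d) is left ex then ex_minn ex else 0%N.

End SymbolPair.

(* Main.v *)
(* Multiplication by u kills u, so u R = F u + F uv, and in R_alpha one has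
   u (x^2 - alpha0)^(p^s) = alpha3 uv.  Hence the code contains the weight-one
   word uv when l <= p^s, and any two distinct words are at pair distance at
   least 2.  When l = p^s + k with k > 0, the code is uv times the ideal
   generated by (x^2 - alpha0)^k in F[x]/(x^2 - alpha0)^(p^s).

   A multiple f = f0(x^2) + x f1(x^2) of (x^2 - alpha0)^k of degree less than
   2p^s has both f0 and f1 divisible by (y - alpha0)^k.  If only one of them is
   nonzero, the support of f has no two cyclically adjacent positions and its
   pair weight is 2 wt f; otherwise its pair weight is at least
   wt f = wt f0 + wt f1.  So the pair distance is twice the Hamming distance of
   the ideal of (y - alpha0)^k in F[y]/(y - alpha0)^(p^s).

   That distance is found by induction on gamma: a multiple of
   (y - a)^((p-1)q) = (y^q - a^q)^(p-1), with q = p^(s-1), is this polynomial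
   times some h of degree less than q, and has weight p wt h.  For gamma = 0, a
   nonzero f of degree less than p^s vanishes at a <> 0 to order at most
   (wt f - 1) p^(s-1). *)
Require Import Defs.
From HB Require Import structures.
From mathcomp Require Import all_boot all_order all_algebra.
From mathcomp Require Import finfield.
From mathcomp Require Import boolp classical_sets.
From mathcomp Require Import mpoly zify ring.

Set Implicit Arguments.
Unset Strict Implicit.
Unset Printing Implicit Defensive.

Import GRing.Theory.
Local Open Scope ring_scope.

(** * Hamming weight of polynomials *)

Section Weight.
Variable R : idomainType.
Implicit Types f g h : {poly R}.

Definition wt f : nat := (\sum_(0 <= i < size f) (f`_i != 0)%R)%N.

Lemma wtE n f : (size f <= n)%N -> wt f = (\sum_(0 <= i < n) (f`_i != 0)%R)%N.
Proof.
move=> le_fn; rewrite (@big_cat_nat _ _ _ (size f)) //= [X in _ = (_ +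
  X)%N]big_nat_cond.
by rewrite [X in _ = (_ + X)%N]big1 ?addn0 // => i /andP[/andP[/leq_sizeP fi _]
  _]; rewrite fi ?eqxx.
Qed.

Lemma wt0 : wt 0 = 0%N.
Proof. by rewrite /wt size_poly0 big_geq. Qed.

Lemma wt_gt0 f : f != 0 -> (0 < wt f)%N.
Proof.
move=> f0; have := f0; rewrite /wt -size_poly_gt0 => /prednK <-.
by rewrite big_nat_recr //= -lead_coefE lead_coef_eq0 f0 addn1.
Qed.

Lemma wt_le_size f : (wt f <= size f)%N.
Proof.
rewrite -[X in (_ <= X)%N]subn0 -[X in (_ <= X)%N]muln1 -sum_nat_const_nat.
by apply: leq_sum => i _; apply: leq_b1.
Qed.

Lemma sum_blocks (F : nat -> nat) n k :
  (\sum_(0 <= i < n * k) F i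
     = \sum_(0 <= j < n) \sum_(0 <= r < k) F (j * k + r))%N.
Proof.
rewrite big_nat_mul; apply: eq_bigr => j _.
rewrite -{1}[(j * k)%N]add0n big_addn mulSn addnK.
by apply: eq_bigr => r _; rewrite addnC.
Qed.

Lemma coef_comp_XnM f h q j r : (size h <= q)%N -> (r < q)%N ->
  ((f \Po 'X^q) * h)`_(j * q + r) = f`_j * h`_r.
Proof.
move=> hq rq; elim/poly_ind: f j => [|f c IHf] j.
  by rewrite comp_poly0 mul0r !coef0 mul0r.
rewrite comp_polyD comp_polyM comp_polyX comp_polyC mulrDl mulrAC.
rewrite !coefD coefMXn coefCM coefMX coefC.
case: j => [|j]; first by rewrite mul0n add0n rq !add0r.
rewrite mulSn -addnA ltnNge leq_addr /= addKn IHf addr0.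
by rewrite [h`_(_ + _)]nth_default ?mulr0 ?addr0 // (leq_trans hq) ?leq_addr.
Qed.

Lemma wt_comp_XnM f h q : (size h <= q)%N ->
  wt ((f \Po 'X^q) * h) = (wt f * wt h)%N.
Proof.
move=> hq; have [->|f0] := eqVneq f 0.
  by rewrite comp_poly0 mul0r wt0.
rewrite (@wtE (size f * q)); last first.
  rewrite (leq_trans (size_polyMleq _ _)) //.
  have:= size_comp_poly_leq f 'X^q; rewrite size_polyXn /=.
  have /prednK <- : (0 < size f)%N by rewrite size_poly_gt0.
  move=> le1; rewrite -subn1 leq_subLR add1n mulSn -addnS addnC.
  by rewrite leq_add.
rewrite sum_blocks [wt f]/wt big_distrl /=. apply: eq_bigr => j _.
rewrite (wtE hq) big_distrr /= !big_mkord; apply: eq_bigr => r _.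
by rewrite coef_comp_XnM // mulf_eq0 negb_or mulnb.
Qed.

Lemma wt_comp_Xn f q : (0 < q)%N -> wt (f \Po 'X^q) = wt f.
Proof.
move=> q0; rewrite -[_ \Po _]mulr1 wt_comp_XnM ?size_poly1 //.
by rewrite /wt size_poly1 big_nat1 coef1 oner_eq0 muln1.
Qed.

Lemma wt_even_odd f : wt f = (wt (even_poly f) + wt (odd_poly f))%N.
Proof.
rewrite (@wtE (size f * 2)); last by lia.
rewrite sum_blocks (@wtE (size f) (even_poly f)); last first.
  by rewrite (leq_trans (size_even_poly _)) //; lia.
rewrite (@wtE (size f) (odd_poly f)); last first.
  by rewrite (leq_trans (size_odd_poly _)) //; lia.
rewrite -big_split; apply: eq_bigr => j _ /=.
by rewrite !big_nat_recr //= big_geq // add0n coef_even_poly coef_odd_poly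
  muln2 addn0 addn1.
Qed.

Lemma wtMX f : wt (f * 'X) = wt f.
Proof.
rewrite (@wtE (size f).+1); last first.
  by rewrite (leq_trans (size_polyMleq _ _)) // size_polyX addn2.
rewrite big_nat_recl //= coefMX /= eqxx add0n.
by apply: eq_bigr => i _; rewrite coefMX.
Qed.

(** The constant term is lost, and multiplying the other coefficients by their exponents creates no
    new nonzero ones. *)
Lemma wt_deriv f : f`_0 != 0 -> (wt f^`() < wt f)%N.
Proof.
move=> f0; rewrite (@wtE (size f).-1 f^`()); last first.
  apply/leq_sizeP => i fi; rewrite coef_deriv nth_default ?mul0rn //.
  by rewrite (leq_trans (leqSpred _)).
have f_gt0 : (0 < size f)%N by rewrite size_poly_gt0;
  apply: contraNneq f0 => ->; rewrite coef0.
rewrite /wt -[in leqRHS](prednK f_gt0) big_nat_recl //= f0 ltnS.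
apply: leq_sum => i _; rewrite coef_deriv.
have [->|_] := eqVneq f`_i.+1 0; first by rewrite mul0rn eqxx.
exact: leq_b1.
Qed.

End Weight.

(** * Weight against order of vanishing in characteristic p *)

Section Multiplicity.
Variables (F : fieldType) (p : nat).
Hypothesis pF : p \in [pchar F].
Implicit Types (f g h : {poly F}) (a : F).

Let p_pr : prime p := pcharf_prime pF.
Let p_gt0 : (0 < p)%N := prime_gt0 p_pr.

Lemma pchar_natX s : ([pchar F]%R).-nat (p ^ s)%N.
Proof. by rewrite pnatX pnatE // pF. Qed.

Lemma exprXsubC_pchar a s :
  ('X - a%:P) ^+ (p ^ s) = 'X^(p ^ s) - (a ^+ (p ^ s))%:P.
Proof.
rewrite exprDn_pchar; last by rewrite (eq_pnat _ (pchar_poly F)) pchar_natX.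
by rewrite -polyCN -polyC_exp exprNn_pchar ?pchar_natX // polyCN.
Qed.

Lemma comp_XsubC_pchar a s :
  ('X - (a ^+ (p ^ s))%:P) \Po 'X^(p ^ s) = ('X - a%:P) ^+ (p ^ s).
Proof. by rewrite comp_polyB comp_polyX comp_polyC exprXsubC_pchar. Qed.

(** Split off from g the full power of X - a^p. Frobenius turns X^p - a^p into (X - a)^p, and the
    cofactor composed with X^p does not vanish at a. *)
Lemma mup_comp_Xp g a : g != 0 ->
  mup a (g \Po 'X^p) = (mup (a ^+ p) g * p)%N.
Proof.
move=> g0; have [k [h]] := multiplicity_XsubC g (a ^+ p).
rewrite g0 /= => h0 ->; rewrite mupMr // mup_XsubCX eqxx.
rewrite comp_polyM rmorphXn /= -[p]expn1 comp_XsubC_pchar expn1 -exprM mupMr.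
  by rewrite mup_XsubCX eqxx mulnC.
by rewrite /root horner_comp hornerXn.
Qed.

(** Coefficient i times i is zero, so only exponents divisible by p survive. *)
Lemma deriv0_comp_Xp f : f^`() = 0 -> exists g, f = g \Po 'X^p.
Proof.
move=> f'0; exists (\poly_(i < size f) f`_(i * p)).
apply/polyP => i; rewrite coef_comp_poly_Xn //.
have [/divnK pi|npi] := boolP (p %| i)%N.
  rewrite coef_poly pi; case: ltnP => // le_f.
  by rewrite nth_default // (leq_trans le_f) // leq_div.
case: i npi => [|i]; first by rewrite dvdn0.
rewrite (dvdn_pcharf pF) => npi; have := coef_deriv f i.
rewrite f'0 coef0 -mulr_natr => /esym/eqP.
by rewrite mulf_eq0 (negPf npi) orbF => /eqP.
Qed.

Lemma mup_deriv f a : f^`() != 0 -> (mup a f <= (mup a f^`()).+1)%N.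
Proof.
move=> f'0; have f0 : f != 0 by apply: contraNneq f'0 => ->; rewrite deriv0.
case E: (mup a f) => [//|k]; rewrite ltnS mup_geq //.
have /dvdpP[g ->] : ('X - a%:P) ^+ k.+1 %| f by rewrite -mup_geq ?E.
rewrite derivM deriv_exp derivXsubC mul1r /= dvdp_add //.
  by rewrite exprS mulrA dvdp_mull.
by rewrite -mulr_natl !dvdp_mull.
Qed.

(* If f(0) <> 0, differentiation loses one term and at most one order of
   vanishing; it is possible unless f is a polynomial in X^p. *)
Lemma mup_le_wt s f a : a != 0 -> f != 0 -> (size f <= p ^ s.+1)%N ->
  (mup a f <= (wt f).-1 * p ^ s)%N.
Proof.
move=> a0 f0 le_f; have [n] := ubnP (size f).
(* Both [s] and [a] are generalized: passing from g(X^p) to g lowers [s] and replaces a by a^p. *)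
elim: n => // n IHn in s f a a0 f0 le_f *; rewrite ltnS => le_fn.
(* A factor X affects neither the weight nor the multiplicity at a nonzero a. *)
have [f00|f00] := eqVneq f`_0 0.
  have /factor_theorem[g fE] : root f 0 by rewrite /root horner_coef0 f00.
  rewrite subr0 in fE; have g0 : g != 0 by apply: contraNneq f0 => g0;
    rewrite fE g0 mul0r.
  move: le_f le_fn; rewrite fE wtMX size_mulX // => le_g le_gn.
  rewrite mupMl ?IHn //; first exact: ltnW.
  by rewrite /root hornerX.
have [/deriv0_comp_Xp[g fE]|f'0] := eqVneq f^`() 0; last first.
  have := wt_deriv f00; have := wt_gt0 f'0; have := mup_deriv a f'0.
  have lt_f' := lt_size_deriv f0.
  have := IHn s _ a a0 f'0 (leq_trans (ltnW lt_f') le_f) (leq_trans lt_f'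
    le_fn).
  have: (0 < p ^ s)%N by rewrite expn_gt0 p_gt0.
  case: (wt f^`()) => // k; case: (wt f) => // k' /=.
  (* The order lost by differentiation is at most 1, hence at most p^s, the allowance for the lost
     term. *)
  move=> ps le1 le2 _ lekk'; apply: leq_trans le2 _.
  by apply: (@leq_trans (k.+1 * p ^ s)%N); [rewrite mulSn;
    lia | rewrite leq_mul2r; lia].
have g0 : g != 0 by apply: contraNneq f0 => g0; rewrite fE g0 comp_poly0.
have sz_f : (size f).-1 = ((size g).-1 * p)%N by rewrite fE size_comp_poly
  size_polyXn.
have szg_gt0 : (0 < size g)%N by rewrite size_poly_gt0.
have szf_gt0 : (0 < size f)%N by rewrite size_poly_gt0.
have [szg1|szg1] := leqP (size g) 1.
  have /size_poly1P[c c0 gE] : size g == 1%N by rewrite eqn_leq szg1 szg_gt0.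
  by rewrite fE gE comp_polyC mupNroot // /root hornerC.
have p_gt1 := prime_gt1 p_pr.
have lt_gf : (size g < size f)%N by nia.
(* For s = 0 a nonconstant polynomial in X^p is too large: its degree is at least p. *)
case: s le_f => [|s] le_f; first by rewrite expn1 in le_f; nia.
have le_g : (size g <= p ^ s.+1)%N by rewrite expnS in le_f; nia.
rewrite fE mup_comp_Xp // wt_comp_Xn // expnSr mulnA leq_mul2r.
by rewrite IHn ?orbT ?expf_neq0 // (leq_trans lt_gf).
Qed.

(** This power is (X^p - b^p) / (X - b), a geometric sum with p nonzero coefficients. *)
Lemma wt_exprXsubC_pred (b : F) : b != 0 -> wt (('X - b%:P) ^+ p.-1) = p.
Proof.
move=> b0; have X0 : 'X - b%:P != 0 by rewrite polyXsubC_eq0.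
have -> : ('X - b%:P) ^+ p.-1 = \poly_(i < p) b ^+ (p.-1 - i).
  apply: (mulfI X0); rewrite -exprS prednK // -[in LHS](expn1 p)
    exprXsubC_pchar.
  rewrite expn1 polyC_exp -opprB subrXX -mulNr opprB poly_def; congr (_ * _).
  by apply: eq_bigr => i _; rewrite -polyC_exp mul_polyC.
rewrite (wtE (size_poly _ _)) -[RHS]subn0 -[RHS]muln1 -sum_nat_const_nat.
rewrite !big_mkord; apply: eq_bigr => i _.
by rewrite coef_poly ltn_ord expf_neq0.
Qed.

(* With q = p^s, (X - a)^(q(p-1)) = (X^q - a^q)^(p-1) has p terms, q apart. *)
Lemma wt_peel s h a : a != 0 -> (size h <= p ^ s)%N ->
  wt (('X - a%:P) ^+ (p ^ s * p.-1) * h) = (p * wt h)%N.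
Proof.
move=> a0 le_h; rewrite exprM -comp_XsubC_pchar -rmorphXn /= wt_comp_XnM //.
by rewrite wt_exprXsubC_pred // expf_neq0.
Qed.

Lemma size_peel s h a : h != 0 ->
  size (('X - a%:P) ^+ (p ^ s * p.-1) * h) = (p ^ s * p.-1 + size h)%N.
Proof.
move=> h0; rewrite size_monicM ?monic_exp ?monicXsubC //.
by rewrite size_exp_XsubC.
Qed.

(** Stripping the factor of [wt_peel] lowers the bounds on [size f] and on [k] by the same amount,
    to those for the preceding [g]; [G] and [s] stay fixed. *)
Lemma wt_lower (G g s k : nat) f a : a != 0 -> f != 0 -> (0 < G < p)%N ->
    (size f <= p ^ (s + g).+1)%N ->
    (p ^ (s + g).+1 - p ^ s.+1 + G.-1 * p ^ s < k)%N ->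
    ('X - a%:P) ^+ k %| f ->
  (G.+1 * p ^ g <= wt f)%N.
Proof.
move=> a0 f0 /andP[G0 Gp]; elim: g f f0 k => [|g IHg] f f0 k le_f lt_k kf.
  move: le_f lt_k; rewrite addn0 subnn add0n muln1 => le_f lt_k.
  have := leq_trans lt_k (eq_ind_r is_true kf (mup_geq a k f0)).
  move=> /leq_trans/(_ (mup_le_wt a0 f0 le_f)).
  (* Here (G - 1) p^s < k <= mup <= (wt f - 1) p^s; cancelling p^s gives G + 1 <= wt f. *)
  by rewrite ltn_mul2r => /andP[_]; have := wt_gt0 f0; lia.
move: le_f lt_k; rewrite addnS => le_f lt_k.
set q := (p ^ (s + g).+1)%N.
have pq : (p ^ (s + g).+2 = q * p.-1 + q)%N.
  by rewrite expnSr -mulnSr prednK.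
have sq : (p ^ s.+1 <= q)%N by rewrite leq_pexp2l // ltnS leq_addr.
have lt_k' : (q * p.-1 + (q - p ^ s.+1 + G.-1 * p ^ s) < k)%N.
  by rewrite addnA addnBA // -pq.
have /dvdpP[h' fE'] := kf.
pose h := h' * ('X - a%:P) ^+ (k - q * p.-1).
have fE : f = ('X - a%:P) ^+ (q * p.-1) * h.
  by rewrite fE' mulrCA -exprD subnKC // (leq_trans (leq_addr _ _) (ltnW
    lt_k')).
have h0 : h != 0 by apply: contraNneq f0 => h0; rewrite fE h0 mulr0.
have le_h : (size h <= q)%N.
  by move: le_f; rewrite fE size_peel // pq leq_add2l.
rewrite fE wt_peel // expnS mulnCA leq_mul2l (IHg h h0 (k - q * p.-1)%N) ?orbT
  //.
  by rewrite ltn_subRL.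
by rewrite dvdp_mull.
Qed.

(** The same peeling ends at (X - a)^(G p^s) = (X^(p^s) - a^(p^s))^G, which has at most G + 1
    terms. *)
Lemma wt_upper (G g s : nat) a : a != 0 -> (G < p)%N ->
  (wt (('X - a%:P) ^+ (p ^ (s + g).+1 - p ^ s.+1 + G * p ^ s)) <= G.+1 * p ^
    g)%N.
Proof.
move=> a0 Gp; elim: g => [|g IHg].
  rewrite addn0 subnn add0n muln1 mulnC exprM -comp_XsubC_pchar -rmorphXn /=.
  rewrite wt_comp_Xn ?expn_gt0 ?p_gt0 // (leq_trans (wt_le_size _)) //.
  by rewrite size_exp_XsubC.
rewrite addnS; set q := (p ^ (s + g).+1)%N.
have pq : (p ^ (s + g).+2 = q * p.-1 + q)%N.
  by rewrite expnSr -mulnSr prednK.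
have sq : (p ^ s.+1 <= q)%N by rewrite leq_pexp2l // ltnS leq_addr.
have -> : (p ^ (s + g).+2 - p ^ s.+1 + G * p ^ s
            = q * p.-1 + (q - p ^ s.+1 + G * p ^ s))%N.
  by rewrite addnA addnBA // -pq.
rewrite exprD wt_peel //; first by rewrite (expnS p g) mulnCA leq_mul2l IHg
  orbT.
rewrite size_exp_XsubC.
(* Since G < p, the remaining exponent is at most q - p^s, so the size fits in one block of length
   q. *)
have : (G.+1 * p ^ s <= p ^ s.+1)%N by rewrite expnS leq_mul2r Gp orbT.
have : (0 < p ^ s)%N by rewrite expn_gt0 p_gt0.
by rewrite mulSn; lia.
Qed.
End Multiplicity.

(** * Even and odd parts of multiples of a polynomial in X^2 *)

Section EvenOdd.
Variable R : nzRingType.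
Implicit Types f d h : {poly R}.

Lemma even_poly_comp_split f h : even_poly (f \Po 'X^2 + (h \Po 'X^2) * 'X) = f.
Proof.
apply/polyP => i; rewrite coef_even_poly coefD coefMX !coef_comp_poly_Xn //.
rewrite -!muln2 dvdn_mull // mulnK //; case: i => [|i]; first by rewrite addr0.
by rewrite /= dvdn2 muln2 /= odd_double addr0.
Qed.

Lemma odd_poly_comp_split f h : odd_poly (f \Po 'X^2 + (h \Po 'X^2) * 'X) = h.
Proof.
apply/polyP => i; rewrite coef_odd_poly coefD coefMX !coef_comp_poly_Xn //.
by rewrite /= dvdn2 oddS odd_double /= add0r -muln2 dvdn_mull // mulnK.
Qed.

End EvenOdd.

(** Multiplication by d(X^2) multiplies the even and the odd part separately by d. *)
Lemma dvdp_even_odd (F : fieldType) (d f : {poly F}) :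
  d \Po 'X^2 %| f -> (d %| even_poly f) && (d %| odd_poly f).
Proof.
case/dvdpP => h ->; rewrite -[h]poly_even_odd mulrDl mulrAC -!rmorphM /=.
by rewrite even_poly_comp_split odd_poly_comp_split !dvdp_mull.
Qed.

(** * Pair distance against Hamming distance *)

Section PairDistance.
Variables (A : eqType) (n : nat).
Implicit Types x y : 'rV[A]_n.

Definition dsupp x y := [set i : 'I_n | x ord0 i != y ord0 i].

Lemma sp_distE x y : sp_dist x y = #|dsupp x y :|: @ordS n @^-1: dsupp x y|.
Proof. by apply: eq_card => i; rewrite !inE xpair_eqE negb_and. Qed.

Lemma card_dsuppS x y : #|@ordS n @^-1: dsupp x y| = #|dsupp x y|.
Proof.
rewrite -(can2_imset_pre _ (@ord_predK n) (@ordSK n)) card_imset //.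
exact: ord_pred_inj.
Qed.

Lemma sp_dist_le x y : (sp_dist x y <= 2 * #|dsupp x y|)%N.
Proof.
by rewrite sp_distE (leq_trans (leq_card_setU _ _)) // card_dsuppS mul2n addnn.
Qed.

Lemma sp_dist_ge x y : (#|dsupp x y| <= sp_dist x y)%N.
Proof. by rewrite sp_distE subset_leq_card // finset.subsetUl. Qed.

Lemma dsupp_gt0 x y : x <> y -> (0 < #|dsupp x y|)%N.
Proof.
move=> xy; rewrite lt0n cards_eq0; apply/eqP => s0; apply: xy.
apply/rowP => i; have := finset.in_set0 i; rewrite -s0 inE => /negbFE/eqP.
by rewrite !ord1.
Qed.

(** A position where the words differ is seen by two pairs, its own and its cyclic predecessor's. *)
Lemma sp_dist_ge2 x y : (1 < n)%N -> x <> y -> (2 <= sp_dist x y)%N.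
Proof.
move=> n1 /dsupp_gt0/card_gt0P[i xi].
have -> : 2%N = #|[set i; ord_pred i]|.
  (* If the two indices coincided, [i] would be its own cyclic successor, impossible for n > 1; the
     wrap at i = n - 1 is treated apart. *)
  rewrite cards2; case: eqVneq => // /(congr1 (@ordS n)).
  rewrite ord_predK => /(congr1 val) /=; case: (ltnP i.+1 n) => [lt_i|ge_i].
    by rewrite modn_small //; lia.
  have -> : i.+1 = n by apply/eqP; rewrite eqn_leq ge_i ltn_ord.
  by rewrite modnn; have := ltn_ord i; lia.
rewrite sp_distE subset_leq_card //; apply/fintype.subsetP => j.
by rewrite !inE => /orP[]/eqP-> ; rewrite ?ord_predK; move: xi;
  rewrite inE => ->; rewrite ?orbT.
Qed.

(** As n is even, the cyclic successor flips parity even at the wrap, so the support and its shift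
    are disjoint. *)
Lemma sp_dist_parity b x y : ~~ odd n -> {in dsupp x y, forall i : 'I_n, odd i
  = b} ->
  (2 * #|dsupp x y| <= sp_dist x y)%N.
Proof.
move=> n2 xb; rewrite sp_distE cardsU card_dsuppS.
suff -> : dsupp x y :&: @ordS n @^-1: dsupp x y = finset.set0.
  by rewrite cards0 subn0 mul2n addnn.
apply/finset.setP => i; rewrite !inE; apply/negbTE/negP => /andP[xi xj].
have := xb (ordS i); rewrite inE => /(_ xj) /=;
  rewrite odd_mod ?(negbTE n2) //=.
by rewrite (xb i) ?inE //; case: b {xb}.
Qed.

Lemma code_sp_distE (C : set 'rV[A]_n) d :
    (exists x y, [/\ C x, C y, x <> y & (sp_dist x y <= d)%N]) ->
    (forall x y, C x -> C y -> x <> y -> (d <= sp_dist x y)%N) ->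
  code_sp_dist C = d.
Proof.
move=> [x [y [Cx Cy xy le_d]]] ge_d; rewrite /code_sp_dist.
case: pselect => [ex|[]]; last first.
  by exists (sp_dist x y); apply/asboolP; exists x, y.
case: ex_minnP => k /asboolP[x' [y' [Cx' Cy' xy' <-]]] min_k.
apply/eqP; rewrite eqn_leq ge_d // andbT (leq_trans _ le_d) // min_k //.
by apply/asboolP; exists x, y.
Qed.

End PairDistance.

(** * Words whose differing positions are the support of a polynomial over another ring *)

Section PolyDistance.
Variables (A : eqType) (R : idomainType) (n : nat) (f : {poly R}).
Variables (x y : 'rV[A]_n).
Hypothesis f_n : (size f <= n)%N.
Hypothesis xyE : forall i : 'I_n, (x ord0 i != y ord0 i) = (f`_i != 0).

Lemma card_dsupp_wt : #|dsupp x y| = wt f.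
Proof.
rewrite (wtE f_n) big_mkord -sum1_card [LHS]big_mkcond /=.
by apply: eq_bigr => i _; rewrite inE xyE; case: eqP.
Qed.

Lemma sp_dist_ge_even_odd d : ~~ odd n -> f != 0 ->
    (even_poly f != 0 -> (d <= wt (even_poly f))%N) ->
    (odd_poly f != 0 -> (d <= wt (odd_poly f))%N) ->
  (2 * d <= sp_dist x y)%N.
Proof.
move=> n2 f0 he ho; have wtf := wt_even_odd f.
have [e0|e0] := eqVneq (even_poly f) 0; last first.
  have [o0|o0] := eqVneq (odd_poly f) 0; last first.
    apply: leq_trans (sp_dist_ge _ _); rewrite card_dsupp_wt wtf.
    by rewrite mul2n -addnn leq_add ?he ?ho.
  apply: leq_trans (sp_dist_parity (b := false) n2 _).
    by rewrite leq_mul2l card_dsupp_wt wtf (leq_trans (he e0)) ?leq_addr ?orbT.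
  move=> i; rewrite inE xyE; apply: contraNF => oi.
  by rewrite -(odd_double_half i) oi -coef_odd_poly o0 coef0.
have o0 : odd_poly f != 0.
  apply: contraNneq f0 => o0; rewrite -[f]poly_even_odd e0 o0.
  by rewrite !comp_poly0 mul0r addr0.
apply: leq_trans (sp_dist_parity (b := true) n2 _).
  by rewrite leq_mul2l card_dsupp_wt wtf (leq_trans (ho o0)) ?leq_addl ?orbT.
move=> i; rewrite inE xyE => /negP fi; apply/negPn/negP => /negbTE oi;
  apply: fi.
by rewrite -(odd_double_half i) oi -coef_even_poly e0 coef0.
Qed.

End PolyDistance.

(** * Generated ideals and the arithmetic of [ringR] *)

Lemma mem_gen_ideal (A : comNzRingType) (g : seq A) (x : A) :
  x \in g -> x \in gen_ideal g.
Proof.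
move=> xg; have ltx : (index x g < size g)%N by rewrite index_mem.
apply/asboolP; exists (fun i => (i == Ordinal ltx)%:R).
rewrite (bigD1 (Ordinal ltx)) //= eqxx mul1r nth_index // big1 ?addr0 //.
by move=> i /negPf->; rewrite mul0r.
Qed.

Lemma gen_ideal1P (A : comNzRingType) (g x : A) :
  reflect (exists c, x = c * g) (x \in gen_ideal [:: g]).
Proof.
apply: (iffP (asboolP _)) => [[c ->]|[c ->]].
  by exists (c ord0); rewrite big_ord1.
by exists (fun=> c); rewrite big_ord1.
Qed.

Section RingRTheory.
Variable F : fieldType.
Implicit Types (x y : ringR F) (f g : {mpoly F[2]}).

Lemma projRD f g : projR (f + g) = projR f + projR g.
Proof. exact: rmorphD. Qed.

Lemma projRM f g : projR (f * g) = projR f * projR g.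
Proof. exact: rmorphM. Qed.

Lemma projR_eq0 f : (projR f == 0) = (f \in @relR F).
Proof.
rewrite -[f in RHS]subr0 Quotient.idealrBE; congr (_ == _).
by rewrite /projR rmorph0.
Qed.

Fact constR_zmod_morphism : zmod_morphism (@constR F).
Proof. by move=> a b; rewrite /constR mpolyCB; apply: rmorphB. Qed.

Fact constR_monoid_morphism : monoid_morphism (@constR F).
Proof.
split; first by rewrite /constR mpolyC1; apply: rmorph1.
by move=> a b; rewrite /constR mpolyCM projRM.
Qed.

HB.instance Definition _ :=
  GRing.isZmodMorphism.Build F (ringR F) (@constR F) constR_zmod_morphism.
HB.instance Definition _ :=
  GRing.isMonoidMorphism.Build F (ringR F) (@constR F) constR_monoid_morphism.

Lemma uR2 : uR * uR = 0 :> ringR F.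
Proof.
by apply/eqP; rewrite -projRM projR_eq0 mem_gen_ideal // inE -expr2 eqxx.
Qed.

Lemma vR2 : vR * vR = 0 :> ringR F.
Proof.
apply/eqP; rewrite -projRM projR_eq0 mem_gen_ideal // !inE -expr2 eqxx.
by rewrite orbT.
Qed.

(* The functional "d/du d/dv at the origin" kills the relations but not uv. *)
Lemma uvR_neq0 : uR * vR != 0 :> ringR F.
Proof.
have subUU (i : 'I_2) : (U_(i) - U_(i) = 0)%MM.
  by apply/mnmP => j; rewrite !mnmE subnn.
rewrite -projRM projR_eq0; apply/negP => /asboolP[c].
move/(congr1 (fun f => meval (fun=> 0) (f^`M(ord0))^`M(ord_max))).
rewrite !big_ord_recr big_ord0 /= add0r (mulrC 'X_ord_max) subrr mulr0 addr0.
rewrite !expr2.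
rewrite !(mderivD, mderivM, mderivX, mevalD, mevalM, mevalXU).
rewrite !mnm1E /= !scale0r !mulr0 !mul0r !meval0 !(mulr0, mul0r, addr0, add0r).
rewrite !scale1r !subUU !mpolyX0 !meval1 mulr1.
by move/eqP; rewrite oner_eq0.
Qed.

(** Since u^2 = v^2 = 0, uv kills every monomial except 1, so only the constant coefficient acts. *)
Lemma uvR_scalar x : exists a, uR * vR * x = uR * vR * constR a.
Proof.
elim/quotW: x => f; rewrite -/(projR f).
elim/mpolyind: f => [|c m f _ _ [a IHf]].
  by exists 0; rewrite rmorph0 mulr0 /projR rmorph0 mulr0.
suff [b Hb] : exists b, uR * vR * projR 'X_[F, m] = uR * vR * constR b.
  exists (c * b + a); rewrite projRD -mul_mpolyC projRM mulrDr IHf.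
  by rewrite mulrCA Hb rmorphD rmorphM /= mulrDr (mulrCA _ (constR c)).
have [->|m0] := eqVneq m 0%MM.
  by exists 1; rewrite mpolyX0 rmorph1 /projR rmorph1.
have /existsP[i mi] : [exists i, m i != 0%N].
  rewrite -negb_forall; apply: contraNN m0 => /forallP m0.
  by apply/eqP/mnmP => i; rewrite mnm0E; apply/eqP.
exists 0; rewrite rmorph0 mulr0.
have -> : 'X_[m] = 'X_i * 'X_[F, m - U_(i)].
  by rewrite -mpolyXD addmC submK // lep1mP.
rewrite projRM mulrA; suff -> : uR * vR * projR 'X_i = 0 :> ringR F by rewrite
  mul0r.
have : (i == ord0) || (i == ord_max) by case: i {mi} => [[|[|]]].
case/orP => /eqP->; first by rewrite mulrAC -/(@uR F) uR2 mul0r.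
by rewrite -mulrA -/(@vR F) vR2 mulr0.
Qed.
End RingRTheory.

(** * The codes, over any ring with the needed relations on u and v *)

Lemma exprX2subC (F : fieldType) (a : F) k :
  ('X^2 - a%:P) ^+ k = ('X - a%:P) ^+ k \Po 'X^2.
Proof. by rewrite rmorphXn /= comp_polyB comp_polyX comp_polyC. Qed.

Section Code.
Variables (F : fieldType) (R : comNzRingType) (cst : {rmorphism F -> R}).
Variables (u v : R) (p s : nat) (a0 a3 a4 : F) (alpha : R).
Hypotheses (u2 : u * u = 0) (v2 : v * v = 0) (uv_neq0 : u * v != 0).
Hypothesis uv_scalar : forall x, exists a, u * v * x = u * v * cst a.
Hypothesis pF : p \in [pchar F].
Hypothesis a0_neq0 : a0 != 0.
Hypothesis a3_neq0 : a3 != 0.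
Hypothesis alphaE : alpha = cst (a0 ^+ (p ^ s)) + cst a3 * v + cst a4 * u * v.

Local Notation N := (2 * p ^ s)%N.
Local Notation M := ('X^N - alpha%:P).
Local Notation pi := (in_qpoly M).
Local Notation uv := (u * v).
Local Notation iota := (map_poly cst).
Local Notation B := ('X^2 - a0%:P).
Local Notation A := ('X^2 - (cst a0)%:P).
Local Notation code l := (code_of (gen_ideal [:: pi (u%:P * A ^+ l)])).

Lemma uv_cst_eq0 a : (uv * cst a == 0) = (a == 0).
Proof.
have [->|a_neq0] := eqVneq a 0; first by rewrite rmorph0 mulr0 eqxx.
apply/negbTE; apply: contraNneq uv_neq0 => uva0.
by rewrite -[uv]mulr1 -(rmorph1 cst) -(divff a_neq0) rmorphM /= mulrA uva0
  mul0r.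
Qed.

Lemma uv_poly_scalar f : exists g, uv%:P * f = uv%:P * iota g.
Proof.
elim/poly_ind: f => [|f c [g fg]]; first by exists 0; rewrite rmorph0.
have [a ca] := uv_scalar c; exists (g * 'X + a%:P).
rewrite rmorphD rmorphM /= map_polyX map_polyC /= !mulrDr !mulrA fg.
by congr (_ + _); rewrite -!polyCM ca.
Qed.

Let p_gt0 : (0 < p)%N := prime_gt0 (pcharf_prime pF).
Let N_gt0 : (0 < N)%N. Proof. by rewrite muln_gt0 expn_gt0 p_gt0. Qed.

Lemma monic_modulus : M \is monic.
Proof. exact: monicXnsubC. Qed.

Lemma mk_monic_modulus : mk_monic M = M.
Proof. by rewrite /mk_monic size_XnsubC // ltnS N_gt0 monic_modulus. Qed.

Lemma pi_modulus : pi M = 0.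
Proof. by apply/val_inj; rewrite /= mk_monic_modulus Pdiv.RingMonic.rmodpp //
  monic_modulus. Qed.

Lemma pi_small (f : {poly R}) : (size f <= N)%N -> pi f = f :> {poly R}.
Proof.
by move=> le_f; rewrite in_qpoly_small // mk_monic_modulus size_XnsubC.
Qed.

Lemma pi_val (h : {poly %/ M}) : pi (h : {poly R}) = h.
Proof. by apply/val_inj/in_qpoly_small/size_mk_monic. Qed.

Lemma expB_pchar : B ^+ (p ^ s) = 'X^N - (a0 ^+ (p ^ s))%:P.
Proof.
rewrite exprX2subC exprXsubC_pchar // comp_polyB comp_polyC comp_Xn_poly.
by rewrite -exprM.
Qed.

Lemma iotaB : iota B = A.
Proof. by rewrite rmorphB /= map_polyXn map_polyC. Qed.

(** From u^2 = 0 comes u alpha = u a0^(p^s) + a3 uv, so u A^(p^s) exceeds u times the modulus by a3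
    uv. *)
Lemma pi_uA : pi (u%:P * A ^+ (p ^ s)) = pi (uv%:P * (cst a3)%:P).
Proof.
have -> : u%:P * A ^+ (p ^ s) = u%:P * M + uv%:P * (cst a3)%:P.
  rewrite -iotaB -rmorphXn /= expB_pchar rmorphB /= map_polyXn map_polyC /=.
  rewrite alphaE !polyCD !polyCM.
  have pu2 : u%:P * u%:P = 0 :> {poly R} by rewrite -polyCM u2.
  rewrite mulrBr !mulrDr.
  ring: pu2.
by rewrite rmorphD rmorphM /= pi_modulus mulr0 add0r.
Qed.

(** Multiplication by uv kills the nilpotent part of [alpha], so uv times the modulus is uv B^(p^s),
    and reduction can take place over F. *)
Lemma pi_uv_modp f : pi (uv%:P * iota (f %% B ^+ (p ^ s))) = pi (uv%:P * iota
  f).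
Proof.
have -> : iota f = iota (f %/ B ^+ (p ^ s)) * iota (B ^+ (p ^ s))
                   + iota (f %% B ^+ (p ^ s)).
  by rewrite -rmorphM -rmorphD -divp_eq.
rewrite mulrDr [uv%:P * (_ * _)]mulrCA.
suff -> : uv%:P * iota (B ^+ (p ^ s)) = uv%:P * M.
  by rewrite [RHS]rmorphD !rmorphM /= pi_modulus !mulr0 add0r.
rewrite expB_pchar rmorphB /= map_polyXn map_polyC /= !mulrBr; congr (_ - _).
rewrite -!polyCM alphaE; congr _%:P.
ring: u2 v2.
Qed.

Definition uv_word f : 'rV[R]_N := poly_rV (uv%:P * iota f).

Lemma size_uv_iota (f : {poly F}) : (size (uv%:P * iota f)%R <= size f)%N.
Proof.
rewrite mul_polyC (leq_trans (size_scale_leq _ _)) //.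
by rewrite (leq_trans (size_poly _ _)).
Qed.

Lemma uv_wordE f i : uv_word f ord0 i = uv * cst f`_i.
Proof. by rewrite mxE coefCM coef_map. Qed.

Lemma uv_word_neq f g i :
  (uv_word f ord0 i != uv_word g ord0 i) = ((f - g)`_i != 0).
Proof.
by rewrite !uv_wordE -subr_eq0 -mulrBr -rmorphB /= uv_cst_eq0 coefB.
Qed.

Lemma code0 l : code l (uv_word 0).
Proof.
exists 0; first exact: gen_ideal0.
by rewrite /uv_word rmorph0 mulr0.
Qed.

Lemma code_uv1 l : (l <= p ^ s)%N -> code l (uv_word 1).
Proof.
move=> le_l; exists (pi (uv%:P)).
  (* The witness raises the exponent of A to p^s, giving a3 uv by [pi_uA], and then cancels a3. *)
  apply/gen_ideal1P; exists (pi (A ^+ (p ^ s - l) * (cst a3^-1)%:P)).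
  rewrite -in_qpolyM.
  have -> : A ^+ (p ^ s - l) * (cst a3^-1)%:P * (u%:P * A ^+ l)
            = u%:P * A ^+ (p ^ s) * (cst a3^-1)%:P.
    by rewrite mulrAC mulrCA -exprD subnK.
  rewrite in_qpolyM pi_uA -in_qpolyM.
  by rewrite -mulrA -[(cst a3)%:P * _]polyCM -[cst a3 * _]rmorphM divff //
    rmorph1 mulr1.
rewrite /word_of /uv_word rmorph1 mulr1; congr poly_rV.
by rewrite pi_small // (leq_trans (size_polyC_leq1 _)).
Qed.

Lemma pi_gen k :
  pi (u%:P * A ^+ (p ^ s + k)) = pi (uv%:P * iota (a3%:P * B ^+ k)).
Proof.
have -> : iota (a3%:P * B ^+ k) = (cst a3)%:P * A ^+ k.
  by rewrite -iotaB -rmorphXn -[in RHS]map_polyC -rmorphM.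
by rewrite exprD [u%:P * _]mulrA in_qpolyM pi_uA -in_qpolyM mulrA.
Qed.

Lemma code_uv_word k (f : {poly F}) : (size f <= N)%N -> B ^+ k %| f ->
  code (p ^ s + k) (uv_word f).
Proof.
move=> le_f /dvdpP[h fE]; exists (pi (uv%:P * iota f)).
  apply/gen_ideal1P; exists (pi (iota (a3^-1%:P * h))).
  rewrite pi_gen -in_qpolyM mulrCA -rmorphM /= fE; congr (pi (_ * iota _)).
  by rewrite mulrACA -polyCM mulVf // mul1r.
by rewrite /word_of pi_small // (leq_trans (size_uv_iota _)).
Qed.

(** The multiplier c acts on uv through a polynomial over F, and the product is then reduced modulo
    B^(p^s). *)
Lemma code_uv_wordP k w : (k <= p ^ s)%N -> code (p ^ s + k) w ->
  exists f : {poly F}, [/\ (size f <= N)%N, B ^+ k %| f & w = uv_word f].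
Proof.
move=> le_k [h /gen_ideal1P[c ->] ->]; rewrite -[c]pi_val pi_gen -in_qpolyM.
have [g gE] := uv_poly_scalar (c : {poly R}).
have sB : size (B ^+ (p ^ s)) = N.+1 by rewrite expB_pchar size_XnsubC.
exists ((g * (a3%:P * B ^+ k)) %% B ^+ (p ^ s)).
set f := _ %% _; have le_f : (size f <= N)%N.
  by rewrite -ltnS -sB ltn_modp -size_poly_gt0 sB.
(* As k <= p^s, B^k divides B^(p^s), so the remainder is still a multiple of B^k. *)
split=> //; first by rewrite -(dvdp_mod _ (dvdp_exp2l B le_k)) mulrA dvdp_mull.
rewrite /word_of /uv_word mulrCA mulrA gE -mulrA -rmorphM -pi_uv_modp pi_small
  //.
exact: leq_trans (size_uv_iota _) le_f.
Qed.

Lemma code_sp_dist_low l : (l <= p ^ s)%N -> code_sp_dist (code l) = 2%N.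
Proof.
move=> le_l; apply: code_sp_distE => [|x y _ _]; last first.
  by apply: sp_dist_ge2; rewrite leq_pmulr // expn_gt0 p_gt0.
have uv1E (i : 'I_N) :
    (uv_word 1 ord0 i != uv_word 0 ord0 i) = ((1 : {poly F})`_i != 0).
  by rewrite uv_word_neq subr0.
have wt1 : wt (1 : {poly F}) = 1%N by rewrite /wt size_poly1 big_nat1 coef1
  oner_eq0.
have card1 : #|dsupp (uv_word 1) (uv_word 0)| = 1%N.
  by rewrite (card_dsupp_wt _ uv1E) ?size_poly1.
exists (uv_word 1), (uv_word 0); split; [exact: code_uv1 | exact: code0 | |].
  move=> eq10; suff : (0 < #|dsupp (uv_word 1) (uv_word 0)|)%N.
    by rewrite eq10 => /card_gt0P[i]; rewrite inE eqxx.
  by rewrite card1.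
by rewrite (leq_trans (sp_dist_le _ _)) // card1.
Qed.

(** Writing s = s' + g + 1 and l = p^s + k gives the bounds the form used in [wt_lower] and
    [wt_upper]. *)
Lemma code_sp_dist_high (G g s' k : nat) :
    (0 < G < p)%N -> s = (s' + g).+1 ->
    (p ^ s - p ^ s'.+1 + G.-1 * p ^ s' < k)%N ->
    (k <= p ^ s - p ^ s'.+1 + G * p ^ s')%N ->
  code_sp_dist (code (p ^ s + k)) = (2 * (G.+1 * p ^ g))%N.
Proof.
(* [K] is the upper end of the range; B^K lies in the code for every k up to [K] and attains the
   distance. *)
move=> Gp sE lt_k le_k; set K := (_ + G * _)%N in le_k.
have lt_K : (K < p ^ s)%N.
  have : (p ^ s'.+1 <= p ^ s)%N by rewrite leq_pexp2l // sE ltnS leq_addr.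
  have : (G * p ^ s' < p ^ s'.+1)%N.
    by rewrite expnS ltn_mul2r expn_gt0 p_gt0; case/andP: Gp.
  rewrite /K; lia.
have le_kp : (k <= p ^ s)%N := leq_trans le_k (ltnW lt_K).
have evenN : ~~ odd N by rewrite oddM.
apply: code_sp_distE => [|x y].
  have fE : B ^+ K = ('X - a0%:P) ^+ K \Po 'X^2 by rewrite exprX2subC.
  have f0 : B ^+ K != 0 by rewrite expf_neq0 // -size_poly_gt0 size_XnsubC.
  have le_f : (size (B ^+ K)%R <= N)%N.
    have := size_exp B K; rewrite size_XnsubC //= => szf.
    have /prednK <- : (0 < size (B ^+ K)%R)%N by rewrite size_poly_gt0.
    by rewrite szf ltn_pmul2l.
  have xyE (i : 'I_N) :
      (uv_word (B ^+ K) ord0 i != uv_word 0 ord0 i) = ((B ^+ K)`_i != 0).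
    by rewrite uv_word_neq subr0.
  have card_f := card_dsupp_wt le_f xyE.
  exists (uv_word (B ^+ K)), (uv_word 0); split.
  - by apply: code_uv_word => //; rewrite dvdp_exp2l.
  - exact: code0.
  - move=> eq0; have : (0 < wt (B ^+ K))%N := wt_gt0 f0.
    by rewrite -card_f eq0 => /card_gt0P[i]; rewrite inE eqxx.
  (* Being a polynomial in X^2, B^K has the weight of (X - a0)^K. *)
  rewrite (leq_trans (sp_dist_le _ _)) // leq_mul2l card_f fE wt_comp_Xn //=.
  by rewrite /K sE wt_upper //; case/andP: Gp.
move=> /(code_uv_wordP le_kp)[f [le_f Bf ->]] /(code_uv_wordP le_kp)[h [le_h Bh
  ->]] neq_fh.
have le_fh : (size (f - h)%R <= N)%N.
  by rewrite (leq_trans (size_polyD _ _)) // size_polyN geq_max le_f.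
have : B ^+ k %| f - h by rewrite dvdp_sub.
rewrite exprX2subC => /dvdp_even_odd/andP[dvde dvdo].
apply: (sp_dist_ge_even_odd le_fh) => // [i|||]; first by rewrite uv_word_neq.
- by apply: contra_not_neq neq_fh => /eqP; rewrite subr_eq0 => /eqP->.
(* The even part has size at most N / 2 = p^s, as [wt_lower] requires. *)
- move=> e0; apply: (wt_lower (s := s') pF a0_neq0 e0 Gp _ _ dvde);
  rewrite -sE //.
  by rewrite (leq_trans (size_even_poly _)) // leq_uphalf_double -mul2n.
- move=> o0; apply: (wt_lower (s := s') pF a0_neq0 o0 Gp _ _ dvdo);
  rewrite -sE //.
  by rewrite (leq_trans (size_odd_poly _)) // leq_half_double -mul2n leqW.
Qed.

End Code.

Theorem theorem5p5 (p m s : nat) (F : finFieldType)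
    (alpha0 alpha1 alpha3 alpha4 : F) (alpha : ringR F) (l : nat)
    (hp : prime p) (hodd : odd p) (hm : (0 < m)%N) (hs : (0 < s)%N)
    (hF : #|F| = (p ^ m)%N)
    (h1 : alpha1 != 0) (h3 : alpha3 != 0) (h4 : alpha4 != 0)
    (halpha : alpha = constR alpha1 + constR alpha3 * vR
                      + constR alpha4 * uR * vR)
    (hnsq : ~ exists beta : ringR F, beta ^+ 2 = alpha)
    (h0 : alpha0 ^+ (p ^ s) = alpha1)
    (hl : (l <= 2 * p ^ s - 1)%N) :
  let Ralpha := constacyclic_ring (2 * p ^ s) alpha in
  let g : Ralpha :=
    in_qpoly _ (uR%:P * ('X^2 - (constR alpha0)%:P) ^+ l) in
  let C := code_of (gen_ideal [:: g]) in
  ((l <= p ^ s)%N -> code_sp_dist C = 2%N)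
  /\
  (forall Gamma gamma : nat,
     (1 <= Gamma <= p - 1)%N -> (gamma <= s - 1)%N ->
     (2 * p ^ s - p ^ (s - gamma) + (Gamma - 1) * p ^ (s - gamma - 1) + 1 <= l)%N ->
     (l <= 2 * p ^ s - p ^ (s - gamma) + Gamma * p ^ (s - gamma - 1))%N ->
     code_sp_dist C = (2 * (Gamma + 1) * p ^ gamma)%N).
Proof.
have pF := card_finPcharP hF hp.
have a0_neq0 : alpha0 != 0.
  by apply: contraNneq h1 => a00; rewrite -h0 a00 expr0n eqn0Ngt expn_gt0 prime_gt0 /= ?eqxx.
move=> Ralpha g C; rewrite -h0 in halpha.
split=> [le_l|G gm /andP[G0 Gp] le_gm lt_l le_l].
  exact: (code_sp_dist_low (cst := @constR F) (@uR2 F) (uvR_neq0 F) pF h3 halpha).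
set s' := (s - gm - 1)%N in lt_l le_l.
have sE : s = (s' + gm).+1 by rewrite /s'; lia.
have s'E : (s - gm)%N = s'.+1 by rewrite /s'; lia.
rewrite s'E in lt_l le_l.
have le_s' : (p ^ s'.+1 <= p ^ s)%N.
  by rewrite leq_pexp2l ?prime_gt0 // sE ltnS leq_addr.
(* The subtraction is exact: p^(s'+1) <= p^s puts the whole range above p^s. *)
have lE : l = (p ^ s + (l - p ^ s))%N by lia.
rewrite /C /g lE -mulnA addn1.
apply: (code_sp_dist_high (cst := @constR F) (s' := s') (@uR2 F) (@vR2 F) (uvR_neq0 F)
  (@uvR_scalar F) pF a0_neq0 h3 halpha) => //; lia.
Qed.
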